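(* Let $X\neq\{0\}$ be a real Banach space and let $T:X\rightrightarrows X^*$ be a maximal monotone operator whose domain $D(T)$ is not a singleton and such that ${}^{ic}D(T)\neq\emptyset$. Then $T$ has property (Q); that is, for every $x\in X$ and every net $(x_i)_{i\in I}$ in $X$ (indexed by a directed set $I$) with $x_i\to x$ in norm, $$\bigcap_{i\in I}\operatorname{cl}_{w^*}\Big(\operatorname{conv}\bigcup_{j\ge i}T(x_j)\Big)\subset T(x).$$
   Context: $X^*$ is the topological dual of $X$, $\langle x,x^*\rangle:=x^*(x)$; $\operatorname{cl}_{w^*}$ is the weak-star closure in $X^*$ and $\operatorname{conv}$ the convex hull. A multifunction $T:X\rightrightarrows X^*$ is identified with its graph $\{(x,x^* )\mid x^*\in T(x)\}$; $D(T)=\{x\mid T(x)\neq\emptyset\}$. $T$ is monotone if $\langle x_1-x_2,x_1^*-x_2^*\rangle\ge0$ for all $(x_1,x_1^* ),(x_2,x_2^* )\in T$; it is maximal monotone if it is monotone and its graph is not properly contained in the graph of another monotone operator $X\rightrightarrows X^*$. For $S\subset X$, the relative algebraic interior ${}^{i}S$ is the set of $s\in S$ such that for every $u\in\operatorname{aff}S$ (affine hull) there is $\rho>0$ with $(1-\lambda)s+\lambda u\in S$ for all $\lambda\in[0,\rho]$; ${}^{ic}S:={}^{i}S$ if $\operatorname{aff}S$ is norm closed, ${}^{ic}S:=\emptyset$ otherwise. *)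

(* Defs.v *)
From HB Require Import structures.
From mathcomp Require Import all_boot all_order all_algebra.
From mathcomp Require Import all_classical all_reals all_analysis.

Set Implicit Arguments.
Unset Strict Implicit.
Unset Printing Implicit Defensive.

Import Order.TTheory GRing.Theory Num.Theory.
Import numFieldNormedType.Exports.

Local Open Scope classical_set_scope.
Local Open Scope ring_scope.

Section Dual.
Variables (R : realType) (X : normedModType R).

Definition continuous_linear : {pred X -> R^o} :=
  [pred f | `[< linear f /\ continuous f >]].

Fact continuous_linear_submod_closed : submod_closed continuous_linear.
Proof.
split.
  apply/asboolP; split => [a x y|x]; last exact: cvg_cst.
  by rewrite /= scaler0 addr0.
move=> a f g /asboolP[lf cf] /asboolP[lg cg]; apply/asboolP; split.
  move=> b x y; pose h z := a *: f z + g z.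
  change (h (b *: x + y) = b *: h x + h y); rewrite /h lf lg.
  by rewrite !scalerDr !scalerA [a * b]mulrC addrACA.
by move=> x; apply: cvgD; [apply: cvgZr; exact: cf | exact: cg].
Qed.

HB.instance Definition _ := GRing.isSubmodClosed.Build R (X -> R^o)
  continuous_linear continuous_linear_submod_closed.

Record topdual : Type := Dual {
  topdual_fun :> X -> R^o;
  _ : topdual_fun \in continuous_linear }.

HB.instance Definition _ := [isSub for topdual_fun].
HB.instance Definition _ := [Choice of topdual by <:].
HB.instance Definition _ := [SubChoice_isSubLmodule of topdual by <:].

(* [topdual] itself carries no topology; the weak-star topology lives on the
   alias [weak_star]. *)
Definition weak_star : Type :=
  initial_topology (fun f : topdual => (f : {ptws X -> R^o})).

HB.instance Definition _ := Topological.on weak_star.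

Definition weak_star_closure (A : set topdual) : set topdual :=
  closure (A : set weak_star).

End Dual.

Definition convex_hull (R : realType) (M : lmodType R) (A : set M) : set M :=
  smallest (@convex_set R M) A.

Definition affine_set (R : realType) (M : lmodType R) (A : set M) : Prop :=
  forall (x y : M) (t : R), A x -> A y -> A ((1 - t) *: x + t *: y).

Definition affine_hull (R : realType) (M : lmodType R) (A : set M) : set M :=
  smallest (@affine_set R M) A.

Definition relative_algebraic_interior (R : realType) (M : lmodType R)
    (S : set M) : set M :=
  [set s | S s /\ forall u, affine_hull S u ->
    exists2 rho : R, 0 < rho &
      forall l : R, 0 <= l <= rho -> S ((1 - l) *: s + l *: u)].

Definition ic_interior (R : realType) (X : normedModType R) (S : set X) :
    set X :=
  if `[< closed (affine_hull S) >] then relative_algebraic_interior S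
  else set0.

Section Monotone.
Variables (R : realType) (X : normedModType R).
Implicit Types T : X -> set (topdual X).

Definition operator_graph T : set (X * topdual X) := [set p | T p.1 p.2].

Definition operator_domain T : set X := [set x | T x !=set0].

Definition monotone_operator T : Prop :=
  forall (x1 x2 : X) (f1 f2 : topdual X),
    operator_graph T (x1, f1) -> operator_graph T (x2, f2) ->
    0 <= (f1 - f2) (x1 - x2).

Definition maximal_monotone_operator T : Prop :=
  monotone_operator T /\
  ~ exists2 T' : X -> set (topdual X), monotone_operator T' &
    operator_graph T `<` operator_graph T'.

End Monotone.

Definition directed_set (I : Type) (le : I -> I -> Prop) : Prop :=
  [/\ inhabited I,
      forall i, le i i,
      forall i j k, le i j -> le j k -> le i k &
      forall i j, exists k, le i k /\ le j k].

(* The section filter of [I]: [x_ @ tails le --> x] is convergence of the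
   net [x_]. *)
Definition tails (I : Type) (le : I -> I -> Prop) : set_system I :=
  filter_from [set: I] (fun i => [set j | le i j]).

Definition property_Q (R : realType) (X : normedModType R)
    (T : X -> set (topdual X)) : Prop :=
  forall (x : X) (I : Type) (le : I -> I -> Prop) (x_ : I -> X),
    directed_set le -> x_ @ tails le --> x ->
    \bigcap_i weak_star_closure
      (convex_hull (\bigcup_(j in [set j | le i j]) T (x_ j))) `<=` T x.

(* Main.v *)
(* Let s be a point of the relative algebraic interior of D(T), and V the closed
   subspace of directions of aff D(T).  By monotonicity, for each u in D(T) the
   quotients <u - y, f> / (1 + |y|), (y, f) in the graph of T, have a common
   upper bound; since s + t v is in D(T) for small t > 0, Baire's theorem
   in V makes the bound uniform on a small ball of s + V.  For f in T(x_j) with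
   x_j close to x this yields, for each N > 0 and all late j,
     N <x_j - x, f> <= K' + <x - s, f>,
   so that monotonicity at (x_j, f) and (y, h) gives
     N <x - y, f - h> + K' + 1 + <x - s, f> >= 0.
   This inequality is affine and weak-star continuous in f, hence it passes to
   weak-star limits of convex combinations; now divide by N and let N tend to
   infinity, and conclude by maximality. *)

Require Import Defs.
From HB Require Import structures.
From mathcomp Require Import all_boot all_order all_algebra.
From mathcomp Require Import all_classical all_reals all_analysis.
From mathcomp Require Import ring lra.

Set Implicit Arguments.
Unset Strict Implicit.
Unset Printing Implicit Defensive.

Import Order.TTheory GRing.Theory Num.Theory.
Import numFieldNormedType.Exports.
Local Open Scope classical_set_scope.
Local Open Scope ring_scope.

(** * Baire category and absorbing convex sets in a closed subspace *)

(** Otherwise there are nested closed balls centred in [V], with radii at least halved at each step,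
    the ball of stage n+1 missing [F n]. The centres converge to a point of [V] outside every
    [F n]. *)
Lemma Baire_closed_subset (R : realType) (X : completeNormedModType R)
    (V : set X) (F : nat -> set X) :
  closed V -> V !=set0 -> (forall n, closed (F n)) -> V `<=` \bigcup_n F n ->
  exists n a r, [/\ V a, 0 < r &
    forall v : X, V v -> `|v - a| <= r -> F n v].
Proof.
move=> clV [v0 Vv0] clF VF; apply: contrapT => noball.
have escape n a (r : R) : V a -> 0 < r ->
    exists v : X, [/\ V v, `|v - a| <= r & ~ F n v].
  move=> Va r0; apply: contrapT => H; apply: noball.
  exists n, a, r; split => // v Vv var; apply: contrapT => Fv.
  by apply: H; exists v.
(* [q] holds the stage n and the current ball, [b] the next one. The conditions on [q] are premises
   inside [P], so that choice applies to every [q]. *)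
pose P (q : nat * (X * R)) (b : X * R) := V q.2.1 -> 0 < q.2.2 ->
  [/\ V b.1, 0 < b.2, b.2 <= q.2.2 / 2, `|b.1 - q.2.1| + b.2 <= q.2.2 &
      forall w : X, `|w - b.1| <= b.2 -> ~ F q.1 w].
have exP q : exists b, P q b.
  case: q => n [a r].
  have [[Va r0]|H] := pselect (V a /\ 0 < r); last first.
    by exists (a, r) => Va r0; case: H.
  have r20 : 0 < r / 2 by rewrite divr_gt0.
  have [v [Vv var Fv]] := escape n a _ Va r20.
  have : nbhs v (~` F n).
    by apply: open_nbhs_nbhs; split => //; rewrite openC.
  move=> /nbhs_normP[e /= e0 eF].
  (* Radius at most r/2 keeps the new ball inside the old one, as [v] is within r/2 of [a]; e/2 < e
     because the new ball is closed and the one avoiding [F n] is open. *)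
  exists (v, Num.min (r / 2) (e / 2)) => _ _ /=; split => //.
  - by rewrite lt_min r20 divr_gt0.
  - by rewrite ge_min lexx.
  - have : Num.min (r / 2) (e / 2) <= r / 2 by rewrite ge_min lexx.
    by move: var => /=; lra.
  - move=> w wv; apply: (eF w) => /=; rewrite distrC.
    apply: (le_lt_trans wv); rewrite gt_min; apply/orP; right.
    by rewrite ltr_pdivrMr// ltr_pMr// ltr1n.
have [f Pf] := boolp.choice exP.
pose fix ar n := if n is p.+1 then f (p, ar p) else (v0, 1 : R).
pose a n := (ar n).1; pose r n := (ar n).2.
have Var n : V (a n) /\ 0 < r n.
  by elim: n => [//|n [Va r0]]; have [] := Pf (n, ar n) Va r0.
have Va n : V (a n) by case: (Var n).
have r0 n : 0 < r n by case: (Var n).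
have step n := Pf (n, ar n) (Va n) (r0 n).
have nested n m : (n <= m)%N -> `|a m - a n| + r m <= r n.
  elim: m => [|m IH].
    by rewrite leqn0 => /eqP ->; rewrite subrr normr0 add0r.
  rewrite leq_eqVlt => /orP[/eqP ->|]; first by rewrite subrr normr0 add0r.
  move=> /IH {}IH; have [_ _ _ /= h _] := step m.
  have := ler_distD (a m) (a m.+1) (a n).
  by rewrite -/(a m) -/(a m.+1) -/(r m.+1) -/(r m) in h *; lra.
have rle n : r n <= 2^-1 ^+ n.
  elim: n => [|n IH]; first by rewrite expr0.
  have [_ _ /= h _ _] := step n.
  rewrite exprS; apply: (le_trans h); rewrite mulrC ler_pM2l//.
have : cvg (a @ \oo).
  apply: cauchy_cvg; apply: cauchy_exP => e e0; rewrite /fmapE -ball_normE /ball_.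
  have /cvgrPdist_lt/(_ e e0)[n _ /(_ n (leqnn n))] :
    (fun n => 2^-1 ^+ n : R) @ \oo --> 0.
    by apply: cvg_expr; rewrite ger0_norm ?invr_ge0// invf_lt1 ?ltr1n.
  rewrite /= sub0r normrN ger0_norm ?exprn_ge0 ?invr_ge0// => ne.
  exists (a n), n => // m /= nm; rewrite distrC.
  by have := nested n m nm; have := r0 m; have := rle n; lra.
move=> /cvg_ex[/= l al].
have Vl : V l.
  by apply: (@closed_cvg _ _ \oo _ a) al => //; apply: nearW.
have [n _ Fl] := VF l Vl.
(* It remains to see that [l] lies in the closed ball of stage n+1, which contains all later
   centres. *)
have [_ _ _ _ /= h] := step n; apply: (h l _ Fl).
rewrite distrC.
have : (fun m => `|a n.+1 - a m|) @ \oo --> `|a n.+1 - l|.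
  by apply: cvg_norm; apply: cvgB => //; exact: cvg_cst.
apply: (@closed_cvg _ _ \oo _ (fun m => `|a n.+1 - a m|) (fun t => t <= r n.+1)).
  exact: closed_le.
exists n.+1 => // m /= nm; rewrite distrC.
by have := nested _ _ nm; have := r0 m; lra.
Qed.

(** Baire's theorem yields a ball of [V] around some [a], a multiple of which lies in one [C n]. A
    convex combination with a negative multiple of [a], available by absorption, moves the centre to
    0. *)
Lemma absorbing_closed_convex_ball (R : realType) (X : completeNormedModType R)
    (V : set X) (C : nat -> set X) :
  closed V -> V 0 -> (forall (u v : X) (c : R), V u -> V v -> V (u + c *: v)) ->
  (forall n, closed (C n)) ->
  (forall m n, (m <= n)%N -> C m `<=` C n) ->
  (forall n (u v : X) (t : R), 0 <= t <= 1 -> C n u -> C n v ->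
    C n (t *: u + (1 - t) *: v)) ->
  (forall v, V v -> exists n, exists2 t : R, 0 < t & C n (t *: v)) ->
  exists n, exists2 rho : R, 0 < rho &
    forall v, V v -> `|v| <= rho -> C n v.
Proof.
move=> clV V0 Vlin clC leC convC absC.
have VZ c v : V v -> V (c *: v).
  by move=> Vv; rewrite -[_ *: _]add0r; apply: Vlin.
have [m0 [t0 _]] := absC 0 V0; rewrite scaler0 => C0.
pose F n : set X := [set v | C n (n.+1%:R^-1 *: v)].
have clF n : closed (F n).
  apply: (@preimage_closed _ _ (fun v : X => n.+1%:R^-1 *: v)) => // v _.
  exact: scaler_continuous.
have VF : V `<=` \bigcup_n F n.
  move=> v /absC[n [t t0' Cn]].
  (* With this [k], both 0 and [t *: v] lie in [C k], and 1/(k+1) <= t puts v/(k+1) on the segment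
     between them. *)
  pose k := maxn (maxn m0 n) (Num.truncn t^-1).
  exists k => //; rewrite /F /=.
  have kt : k.+1%:R^-1 / t <= 1.
    rewrite ler_pdivrMr// mul1r invf_ple ?posrE//.
    apply: (@le_trans _ _ (Num.truncn t^-1).+1%:R); first exact/ltW/truncnS_gt.
    by rewrite ler_nat ltnS leq_maxr.
  have -> : k.+1%:R^-1 *: v =
      (k.+1%:R^-1 / t) *: (t *: v) + (1 - k.+1%:R^-1 / t) *: 0.
    by rewrite scaler0 addr0 scalerA divfK ?gt_eqF.
  apply: convC.
  - by rewrite kt andbT divr_ge0 // ltW.
  - by apply: leC Cn; rewrite /k -maxnA maxnCA leq_maxl.
  - by apply: leC C0; rewrite /k -maxnA leq_maxl.
have [n [a [r [Va r0 Fr]]]] := Baire_closed_subset clV (ex_intro _ 0 V0) clF VF.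
have [m [t t0' Cm]] := absC _ (VZ (-1) _ Va).
pose b : R := n.+1%:R^-1.
have b0 : 0 < b by rewrite invr_gt0.
have tb0 : 0 < t + b by rewrite addr_gt0.
(* Weights t/(t+b) on b(a+w) and b/(t+b) on -ta cancel [a] and leave w scaled by tb/(t+b). *)
exists (maxn n m), (r * (t * b / (t + b))).
  by rewrite !mulr_gt0// invr_gt0.
move=> v Vv vr.
pose w := ((t + b) / (t * b)) *: v.
have wr : `|w| <= r.
  rewrite normrZ gtr0_norm ?divr_gt0 ?mulr_gt0//.
  by rewrite -ler_pdivlMl ?divr_gt0 ?mulr_gt0// invf_div mulrC.
have Caw : C (maxn n m) (b *: (a + w)).
  apply: (leC n); first exact: leq_maxl.
  apply: Fr; last by rewrite addrAC subrr add0r.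
  exact: Vlin.
have Cta : C (maxn n m) (t *: (-1 *: a)).
  by apply: leC Cm; exact: leq_maxr.
have -> : v = (t / (t + b)) *: (b *: (a + w)) +
              (1 - t / (t + b)) *: (t *: (-1 *: a)).
  have tbn0 : t + b != 0 by rewrite gt_eqF.
  rewrite /w !scalerDr !scalerA addrAC -scalerDl.
  rewrite [X in X *: a](_ : _ = 0); last by field.
  rewrite scale0r add0r [X in X *: v](_ : _ = 1) ?scale1r//; field.
  by rewrite !gt_eqF.
apply: convC => //.
by rewrite divr_ge0 ?(ltW t0') ?(ltW tb0)//= ler_pdivrMr// mul1r lerDl ltW.
Qed.

(** * Affine sets, continuous functionals and the weak-star topology *)

(** The translate A - s is a linear subspace: lines through [s] give multiples, and s + u + cv is
    the midpoint of s + 2u and s + 2cv. *)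
Lemma affine_set_shift (R : realType) (M : lmodType R) (A : set M) (s : M) :
  affine_set A -> A s ->
  forall (u v : M) (c : R), A (s + u) -> A (s + v) -> A (s + (u + c *: v)).
Proof.
move=> affA As u v c Au Av.
have Ah w k : A (s + w) -> A (s + k *: w).
  move=> Aw; have := affA _ _ k As Aw.
  by rewrite scalerDr addrA -scalerDl subrK scale1r.
have := affA _ _ (2^-1) (Ah _ 2 Au) (Ah _ (2 * c) Av).
rewrite !scalerDr !scalerA addrACA -scalerDl subrK scale1r mulrA.
rewrite mulVf ?pnatr_eq0// mul1r [X in X *: u](_ : _ = 1) ?scale1r//.
by field.
Qed.

Lemma topdual_linear (R : realType) (X : normedModType R) (f : topdual X) :
  linear f.
Proof. by case: f => f /= /asboolP[]. Qed.

HB.instance Definition _ (R : realType) (X : normedModType R)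
    (f : topdual X) :=
  GRing.isLinear.Build R X R^o *:%R (topdual_fun f) (topdual_linear f).

Lemma topdual_continuous (R : realType) (X : normedModType R)
    (f : topdual X) : continuous f.
Proof. by case: f => f /= /asboolP[]. Qed.

Lemma topdualD (R : realType) (X : normedModType R) (f : topdual X) (x y : X) :
  f (x + y) = f x + f y.
Proof. exact: linearD. Qed.

Lemma topdualZ (R : realType) (X : normedModType R) (f : topdual X) (c : R)
    (x : X) :
  f (c *: x) = c * f x.
Proof. exact: linearZ. Qed.

Lemma topdualN (R : realType) (X : normedModType R) (f : topdual X) (x : X) :
  f (- x) = - f x.
Proof. exact: linearN. Qed.

Lemma topdual_bound (R : realType) (X : normedModType R) (f : topdual X) :
  exists2 K : R, 0 <= K & forall x, `|f x| <= K * `|x|.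
Proof.
have /linear_boundedP/pinfty_ex_gt0[K K0 fK] : bounded_near f (nbhs (0 : X)).
  by apply: continuous_linear_bounded; exact: topdual_continuous.
by exists K => //; exact: ltW.
Qed.

Lemma weak_star_eval_continuous (R : realType) (X : normedModType R) (w : X) :
  continuous (fun f : weak_star X => (f : topdual X) w : R^o).
Proof.
move=> f; apply: (@continuous_comp _ _ _
  (fun f : weak_star X => (f : topdual X) : {ptws X -> R^o})
  (fun g : {ptws X -> R^o} => g w)).
  exact: initial_continuous.
exact: (@proj_continuous X (fun=> R^o) w).
Qed.

(** The half-space of all f with c <= f w is convex, and weak-star closed since evaluation at [w] is
    weak-star continuous. *)
Lemma weak_star_closure_convex_hull_ge (R : realType) (X : normedModType R)
    (A : set (topdual X)) (w : X) (c : R) :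
  (forall f : topdual X, A f -> c <= f w) ->
  forall f : topdual X, weak_star_closure (convex_hull A) f -> c <= f w.
Proof.
move=> Ac; pose H : set (weak_star X) := [set f | c <= (f : topdual X) w].
have clH : closed H.
  apply: (@preimage_closed _ _ (fun f : weak_star X => (f : topdual X) w : R^o)
    [set t | c <= t]); last exact: closed_ge.
  by move=> f _; exact: weak_star_eval_continuous.
have convH : @convex_set R (topdual X) H.
  move=> f g k; rewrite !inE /H /= => cf cg.
  change (c <= k%:num * f w + (1 - k%:num) * g w).
  have kf : k%:num * c <= k%:num * f w by rewrite ler_wpM2l.
  have kg : (1 - k%:num) * c <= (1 - k%:num) * g w.
    by rewrite ler_wpM2l// subr_ge0.
  by have := lerD kf kg; rewrite -mulrDl addrC subrK mul1r.
have AH : convex_hull A `<=` H by move=> f hf; exact: (hf H (conj convH Ac)).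
move=> f /(@closureS (weak_star X) (convex_hull A) H AH).
by rewrite -(closure_id H).1.
Qed.

Lemma topdualB (R : realType) (X : normedModType R) (f g : topdual X) (x : X) :
  (f - g) x = f x - g x.
Proof. by []. Qed.

(** * Bounds on a monotone operator near a relative interior point *)

Lemma affine_hull_affine (R : realType) (M : lmodType R) (A : set M) :
  affine_set (affine_hull A).
Proof.
move=> x y t Ax Ay B [affB AB].
exact: affB (Ax B (conj affB AB)) (Ay B (conj affB AB)).
Qed.

(** For g in T(u), monotonicity gives f(u - y) <= g(u - y) <= K(|u| + |y|). The bound is a natural
    number so that Baire's theorem can be applied to the sets it indexes. *)
Lemma monotone_domain_bound (R : realType) (X : normedModType R)
    (T : X -> set (topdual X)) (u : X) :
  monotone_operator T -> operator_domain T u ->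
  exists n : nat, forall (y : X) (f : topdual X), T y f ->
    f (u - y) <= n%:R * (1 + `|y|).
Proof.
move=> monT [g Tug]; have [K K0 gK] := topdual_bound g.
exists (Num.truncn (K * `|u| + K)).+1 => y f Tyf.
have := monT u y g f Tug Tyf; rewrite topdualB subr_ge0 => /le_trans; apply.
apply: (le_trans (ler_norm _)); apply: (le_trans (gK _)).
have := truncnS_gt (K * `|u| + K); set N := (_.+1%:R : R) => KN.
have Ku0 : 0 <= K * `|u| by rewrite mulr_ge0.
have KNy : K * `|y| <= N * `|y| by rewrite ler_wpM2r//; lra.
have := ler_wpM2l K0 (ler_normB u y).
by rewrite !mulrDr mulr1; lra.
Qed.

(* The lower bound <y - s, f> >= <v, f> - K (1 + |y|) over the ball of radius
   rho controls the norm of f restricted to the directions of the affine hull. *)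
Lemma monotone_ic_interior_bound (R : realType) (X : completeNormedModType R)
    (T : X -> set (topdual X)) (s : X) :
  monotone_operator T -> closed (affine_hull (operator_domain T)) ->
  relative_algebraic_interior (operator_domain T) s ->
  exists2 K : R, 0 <= K & exists2 rho : R, 0 < rho &
    forall v : X, affine_hull (operator_domain T) (s + v) -> `|v| <= rho ->
    forall (y : X) (f : topdual X), T y f -> f (s + v - y) <= K * (1 + `|y|).
Proof.
move=> monT clA [Ds sint]; set A := affine_hull _ in clA sint *.
have As : A s by apply: sub_gen_smallest.
have affA : affine_set A by exact: affine_hull_affine.
(* These sets are closed and convex as intersections of half-spaces over the graph, and they
   increase with n. *)
pose C (n : nat) : set X := [set v : X | forall (y : X) (f : topdual X),
  T y f -> f (s + v - y) <= n%:R * (1 + `|y|)].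
have [n [rho rho0 nrho]] : exists n, exists2 rho : R, 0 < rho &
    forall v, A (s + v) -> `|v| <= rho -> C n v.
  apply: (@absorbing_closed_convex_ball _ _ [set v | A (s + v)]).
  - apply: (@preimage_closed _ _ (fun v : X => s + v)) => // v _.
    by apply: cvgD; [exact: cvg_cst | exact: cvg_id].
  - by rewrite /= addr0.
  - by move=> u v c; exact: affine_set_shift.
  - move=> n; rewrite (_ : C n = \bigcap_(p in [set p | T p.1 p.2])
      (fun v : X => p.2 (s + v - p.1) : R^o) @^-1`
        [set t | t <= n%:R * (1 + `|p.1|)]).
      apply: closed_bigI => -[y f] /= Tyf; apply: preimage_closed.
        move=> v _; apply: (@continuous_comp _ _ _ (fun v => s + v - y) f).
          apply: cvgB; last exact: cvg_cst.
          by apply: cvgD; [exact: cvg_cst | exact: cvg_id].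
        exact: topdual_continuous.
      exact: closed_le.
    apply/seteqP; split => v /= Cv; first by move=> [y f] /= Tyf; apply: Cv.
    by move=> y f Tyf; exact: (Cv (y, f)).
  - move=> m n mn v Cm y f /Cm /le_trans; apply.
    by rewrite ler_wpM2r ?addr_ge0// ler_nat.
  - move=> n u v t /andP[t0 t1] Cu Cv y f Tyf.
    have -> : s + (t *: u + (1 - t) *: v) - y =
        t *: (s + u - y) + (1 - t) *: (s + v - y).
      rewrite (addrAC s u) (addrAC s v) [LHS]addrAC; set z := s - y.
      rewrite (scalerDr t) (scalerDr (1 - t)) [RHS]addrACA -scalerDl.
      by rewrite [t + _]addrC subrK scale1r.
    have t1' : 0 <= 1 - t by rewrite subr_ge0.
    have := lerD (ler_wpM2l t0 (Cu y f Tyf)) (ler_wpM2l t1' (Cv y f Tyf)).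
    by rewrite -mulrDl [t + _]addrC subrK mul1r -!topdualZ -topdualD.
  (* Absorption: relative interiority puts s + rho v in D(T), where the pointwise bound holds. *)
  - move=> v Asv; have [rho rho0 srho] := sint _ Asv.
    have : operator_domain T (s + rho *: v).
      have := srho rho; rewrite lexx ltW//= => /(_ isT).
      by rewrite scalerDr addrA -scalerDl subrK scale1r.
    by move=> /(monotone_domain_bound monT)[n Cn]; exists n, rho.
by exists n%:R => //; exists rho => // v Av vrho; exact: nrho.
Qed.

(** * Maximality and property (Q) *)

(** Adding (x, g) to the graph keeps it monotone, so by maximality the pair was already there. *)
Lemma maximal_monotoneP (R : realType) (X : normedModType R)
    (T : X -> set (topdual X)) (x : X) (g : topdual X) :
  maximal_monotone_operator T ->
  (forall (y : X) (f : topdual X), T y f -> 0 <= (g - f) (x - y)) -> T x g.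
Proof.
move=> [monT maxT] xg; apply: contrapT => Txg; apply: maxT.
exists (fun y => T y `|` [set f | y = x /\ f = g]).
  move=> x1 x2 f1 f2; rewrite /operator_graph /=.
  move=> [T1|[-> ->]] [T2|[-> ->]].
  - exact: monT.
  - by have := xg _ _ T1; rewrite !topdualB -(opprB x1 x) !topdualN opprK addrC.
  - exact: xg.
  - by rewrite subrr.
split=> [p Tp|sub]; first by left.
by apply: Txg; apply: (sub (x, g)); right.
Qed.

Theorem theorem41 (R : realType) (X : completeNormedModType R)
    (T : X -> set (topdual X)) :
  [set: X] <> [set 0] ->
  maximal_monotone_operator T ->
  ~ (exists x, operator_domain T = [set x]) ->
  ic_interior (operator_domain T) !=set0 ->
  property_Q T.
Proof.
move=> _ maxT _ [s]; rewrite /ic_interior; case: asboolP => // clA sint.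
have [K K0 [rho rho0 Trho]] := monotone_ic_interior_bound maxT.1 clA sint.
set A := affine_hull _ in clA Trho.
have affA : affine_set A by exact: affine_hull_affine.
have DA : operator_domain T `<=` A by exact: sub_gen_smallest.
have As : A s by apply: DA; case: sint.
move=> x I le x_ _ x_x g gQ.
have late (P : X -> Prop) : (\forall y \near x, P y) ->
    exists i, forall j, le i j -> P (x_ j).
  by move=> /x_x[i _ iP]; exists i.
have Ax : A x.
  apply: clA => B /late[i iB].
  have [[f [j /= ij Tf]]|Ti0] :=
      pselect (\bigcup_(j in [set j | le i j]) T (x_ j) !=set0).
    by exists (x_ j); split; [apply: DA; exists f | exact: iB].
  (* The hull of an empty tail satisfies every lower bound vacuously, so [g] would satisfy 1 <= g 0
     = 0. *)
  have false_ge (c : R) : c <= g 0.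
    apply: (weak_star_closure_convex_hull_ge _ (gQ i Logic.I)) => f Tf.
    by case: Ti0; exists f.
  by have := false_ge 1; rewrite linear0 ler10.
have Dx y : A y -> A (s + (y - x)).
  move=> Ay; have := affine_set_shift affA As (-1) (u := y - s) (v := x - s).
  rewrite !subrKC scaleN1r => /(_ Ay Ax).
  by rewrite opprB [y - s + _]addrA subrK.
apply: maximal_monotoneP => // y h Tyh.
(* Bounds K(1 + |x_j|) as soon as |x_j - x| <= 1. *)
pose K' := K * (2 + `|x|).
suff main (N : R) : 0 < N ->
    N * h (x - y) - (K' + 1) <= g (N *: (x - y) + (x - s)).
  rewrite topdualB leNgt; apply/negP => neg.
  pose d := h (x - y) - g (x - y).
  have d0 : 0 < d by rewrite /d; lra.
  (* [main] reads N d <= K' + 1 + g(x - s); the choice N = c/d makes the left side [c], which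
     exceeds the right side. *)
  pose c := `|K' + 1 + g (x - s)| + 1.
  have c0 : 0 < c by rewrite ltr_pwDr.
  have := main (c / d) (divr_gt0 c0 d0).
  rewrite (topdualD g (_ *: _)) topdualZ => le1.
  have : c / d * d <= K' + 1 + g (x - s) by rewrite /d in le1 *; lra.
  rewrite divfK ?gt_eqF// leNgt => /negP; apply.
  by rewrite /c ltr_pwDr// ler_norm.
move=> N0.
(* The factor is N + 1 because evaluating the bound at s + (N+1)(x_j - x) subtracts x_j, which uses
   up one copy and leaves N(x_j - x) - (x - s). *)
have [i Hi] : exists i, forall j, le i j ->
    [/\ `|x_ j - x| <= 1, `|(N + 1) *: (x_ j - x)| <= rho
       & N * h (x - x_ j) <= 1].
  apply: (late (fun z => [/\ `|z - x| <= 1, `|(N + 1) *: (z - x)| <= rho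
    & N * h (x - z) <= 1])).
  have zx : (z - x) @[z --> x] --> (0 : X).
    by rewrite -(subrr x); apply: cvgB; [exact: cvg_id | exact: cvg_cst].
  have Nzx : ((N + 1) *: (z - x)) @[z --> x] --> (0 : X).
    by rewrite -(scaler0 _ (N + 1)); exact: cvgZr.
  have hzx : (N * h (x - z) : R^o) @[z --> x] --> (0 : R^o).
    have xz : (x - z) @[z --> x] --> (0 : X).
      by rewrite -(subrr x); apply: cvgB; [exact: cvg_cst | exact: cvg_id].
    have h0 : h z @[z --> (0 : X)] --> (0 : R^o).
      by have := @topdual_continuous R X h 0; rewrite /continuous_at linear0.
    by rewrite -(mulr0 N); apply: cvgMr; exact: cvg_comp xz h0.
  near=> z; split.
  - near: z; apply: cvgr0_norm_le zx _ _; exact: ltr01.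
  - near: z; exact: cvgr0_norm_le Nzx _ rho0.
  - apply: (le_trans (ler_norm _)); near: z.
    exact: (@cvgr0_norm_le _ R^o _ _ _ (fun z => N * h (x - z)) hzx _ ltr01).
(* The inequality bounds the value of [g] at a fixed vector from below, so it suffices to prove it
   for f in T(x_j) with j past [i]. *)
apply: (weak_star_closure_convex_hull_ge _ (gQ i Logic.I)).
move=> f [j /= /Hi[xj1 xjrho xjh] Tf].
have Axj : A (x_ j) by apply: DA; exists f.
have shift : A (s + (N + 1) *: (x_ j - x)).
  have := affine_set_shift affA As (N + 1) (u := 0) (v := x_ j - x).
  by rewrite addr0 add0r; apply=> //; exact: Dx.
have := Trho _ shift xjrho _ _ Tf.
have -> : s + (N + 1) *: (x_ j - x) - x_ j = N *: (x_ j - x) - (x - s).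
  rewrite scalerDl scale1r opprB addrCA -addrA (addrCA s).
  by rewrite [x_ j + _ - _]addrAC subrr add0r.
have xjK : K * (1 + `|x_ j|) <= K'.
  rewrite ler_wpM2l// (_ : 2 = 1 + 1)// -addrA lerD2l.
  by have := ler_normD (x_ j - x) x; rewrite subrK; lra.
have := maxT.1 _ _ _ _ Tf Tyh; rewrite topdualB.
have -> : x_ j - y = (x_ j - x) + (x - y) by rewrite addrA subrK.
move: xjh; rewrite -(opprB (x_ j) x).
rewrite !(topdualN, topdualD, topdualZ).
(* N times the monotonicity inequality, plus N f(x_j - x) <= K' + f(x - s) and N h(x - x_j) <= 1. *)
by nra.
Unshelve. all: by end_near. Qed.
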